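(* Let $\kappa:(a,b)\to\mathbb{R}$ be a differentiable function with $\kappa(s)>0$ for all $s\in(a,b)$, and let $\tau:(a,b)\to\mathbb{R}$ be a continuous function. Then there exist a nonempty open interval $J\subset(a,b)$ and a regular parametrized curve $\alpha:J\to\mathbb{R}^3$ such that $s$ is the arc length of $\alpha$, $\kappa(s)$ is the curvature of $\alpha$ and $\tau(s)$ is the torsion of $\alpha$ for all $s\in J$. Moreover, any other curve $\widetilde{\alpha}:J\to\mathbb{R}^3$ satisfying the same conditions (parametrized by arc length $s$, with curvature $\kappa(s)$ and torsion $\tau(s)$) differs from $\alpha$ by a rigid motion; that is, there exist an orthogonal linear map $\rho$ of $\mathbb{R}^3$ with positive determinant and a vector $c\in\mathbb{R}^3$ such that $\widetilde{\alpha}=\rho\circ\alpha+c$.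
   Context: Curves are assumed sufficiently differentiable for the following to make sense (three times differentiable). For a curve $\alpha$ parametrized by arc length $s$ (i.e. $\|\alpha'(s)\|=1$), the tangent vector is $\mathbf{t}=\alpha'$ and the curvature is $\kappa=\|\alpha''\|$. When $\kappa>0$, the principal normal is $\mathbf{n}=\alpha''/\kappa$, the binormal is $\mathbf{b}=\mathbf{t}\wedge\mathbf{n}$ (cross product), and the torsion $\tau$ is defined by the Frenet equations, with sign convention $$\frac{d\mathbf{t}}{ds}=\kappa\mathbf{n},\qquad \frac{d\mathbf{n}}{ds}=-\kappa\mathbf{t}+\tau\mathbf{b},\qquad \frac{d\mathbf{b}}{ds}=-\tau\mathbf{n}.$$ Equivalently $\tau=\dfrac{(\alpha'\wedge\alpha'')\cdot\alpha'''}{\|\alpha'\wedge\alpha''\|^2}$. *)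

(* Defs.v *)
From HB Require Import structures.
From mathcomp Require Import all_boot all_order all_algebra.
From mathcomp Require Import all_classical all_reals all_analysis.
Set Implicit Arguments.
Unset Strict Implicit.
Unset Printing Implicit Defensive.
Import Order.TTheory GRing.Theory Num.Theory.
Import numFieldNormedType.Exports.
Local Open Scope classical_set_scope.
Local Open Scope ring_scope.

Section space_curves.
Context {R : realType}.

(* R^3 is 'cV[R]_3.  The library norm `|_| on matrices is the sup norm; it is
   only used for the topology (hence for derivatives), never for lengths. *)
Implicit Types (u v : 'cV[R]_3) (alpha : R -> 'cV[R]_3).

Definition dotv u v : R := \sum_(i < 3) u i 0 * v i 0.

Definition enorm u : R := Num.sqrt (dotv u u).

(* Cyclic indexing: 'I_3 is Z/3, so component i of the cross product is
   u_(i+1) v_(i+2) - u_(i+2) v_(i+1). *)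
Definition crossv u v : 'cV[R]_3 :=
  \col_(i < 3) (u (i + 1) 0 * v (i + 2%:R) 0 - u (i + 2%:R) 0 * v (i + 1) 0).

Definition orthogonal_mx (rho : 'M[R]_3) : Prop := rho^T *m rho = 1%:M.

(* A curve is a total function of which only the values on an open interval J
   matter: on J, derivatives depend only on the restriction to J. *)
Definition thrice_differentiable_on (J : set R) alpha : Prop :=
  forall s, J s -> forall k, (k < 3)%N -> derivable (derive1n k alpha) s 1.

Definition regular_on (J : set R) alpha : Prop :=
  forall s, J s -> derive1 alpha s != 0.

Definition arclength_on (J : set R) alpha : Prop :=
  forall s, J s -> enorm (derive1 alpha s) = 1.

(* The Frenet apparatus below is that of a curve parametrized by arc length. *)
Definition curvature alpha (s : R) : R := enorm (derive1n 2 alpha s).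

Definition tangent alpha (s : R) : 'cV[R]_3 := derive1 alpha s.

Definition normal alpha (s : R) : 'cV[R]_3 :=
  (curvature alpha s)^-1 *: derive1n 2 alpha s.

Definition binormal alpha (s : R) : 'cV[R]_3 :=
  crossv (tangent alpha s) (normal alpha s).

(* The torsion at s, where the curvature is positive, is the number tau for
   which the Frenet equations hold at s. *)
Definition is_torsion alpha (s tau : R) : Prop :=
  [/\ is_derive s 1 (tangent alpha) (curvature alpha s *: normal alpha s),
      is_derive s 1 (normal alpha)
        (- curvature alpha s *: tangent alpha s + tau *: binormal alpha s)
    & is_derive s 1 (binormal alpha) (- tau *: normal alpha s)].

Definition has_curvature_torsion (J : set R) (kappa tau : R -> R) alpha : Prop :=
  [/\ thrice_differentiable_on J alpha,
      regular_on J alpha,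
      arclength_on J alpha,
      forall s, J s -> curvature alpha s = kappa s
    & forall s, J s -> is_torsion alpha s (tau s)].

End space_curves.

(* Main.v *)
Require Import Defs.
From mathcomp Require Import all_boot all_order all_algebra.
From mathcomp Require Import all_classical all_reals all_analysis.
From mathcomp Require Import ring lra.
Import Order.TTheory GRing.Theory Num.Theory.
Import numFieldNormedType.Exports.
Set Implicit Arguments.
Unset Strict Implicit.
Unset Printing Implicit Defensive.
Local Open Scope classical_set_scope.
Local Open Scope ring_scope.

(** Stack the tangent, the normal and the binormal as the rows of a 3 x 3
    matrix F.  The Frenet equations then become one linear equation F' = A F,
    where A = [frenet_mx kappa tau] is skew-symmetric.  The whole theorem rests
    on one consequence of skew-symmetry ([skew_ode_gram_constant]): if F and G
    both solve this equation, then (G^T F)' = G^T (A^T + A) F = 0, so that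
    G^T F is constant.

    Rigidity ([curve_rigidity]): let F and G be the frames of two curves alpha
    and beta with the same curvature and torsion.  Then rho = G^T F is a
    constant rotation; it carries each vector of the frame of alpha to the
    corresponding vector of the frame of beta, because F F^T = 1.  In particular
    beta' = rho alpha', and beta - rho alpha is constant.  No uniqueness theorem
    for differential equations is involved.

    Existence: Picard iteration ([linear_ode]) gives a solution F of F' = A F on
    a short interval around an interior point m, with F(m) = 1.  The case G = F
    of the consequence above shows that F stays orthogonal; moreover det F stays
    equal to 1, since its derivative vanishes ([frenet_ode_det_constant]).
    Hence the rows u, v, w of F are orthonormal with w = u x v.  A primitive
    alpha of u is the curve: alpha' = u is a unit vector and
    alpha'' = u' = kappa v, so that u, v, w are its tangent, normal and
    binormal, and the rows of F' = A F are its Frenet equations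
    ([has_curvature_torsion_of_frame]). *)

(** * Primitives frozen outside a compact interval *)

Section clamp.
Context {R : realType}.
Implicit Types (m r s : R).

Definition clamp m r s : R := Num.max (m - r) (Num.min (m + r) s).

Lemma clamp_in m r s : 0 <= r -> m - r <= clamp m r s <= m + r.
Proof.
move=> r0; rewrite /clamp le_max lexx/= ge_max ge_min lexx/= andbT.
by rewrite lerD2l ge0_cp.
Qed.

Lemma clampK m r s : m - r <= s <= m + r -> clamp m r s = s.
Proof. by move=> /andP[ms sm]; rewrite /clamp min_r// max_r. Qed.

Lemma continuous_clamp m r : continuous (clamp m r).
Proof.
move=> s; apply: (@continuous_max _ _ (cst (m - r)) (fun s => Num.min (m + r) s)).
  exact: cst_continuous.
by apply: (@continuous_min _ _ (cst (m + r)) id) => //; exact: cst_continuous.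
Qed.

End clamp.

Section primitive.
Context {R : realType}.
Variables (m r : R).
Hypothesis r_gt0 : 0 < r.
Implicit Types (f g : R -> R) (s : R).

Let mu := @lebesgue_measure R.

Let F f x : R := \int[mu]_(t in `[m - r - 1, x]) f t.

Let F_derive f (x : R) : continuous f -> m - r <= x -> is_derive x 1 (F f) (f x).
Proof.
move=> cf mx.
have [] := @continuous_FTC1_closed R f (m - r - 1) x (x + 1) _ _ _ (cf x).
- by rewrite ltrDl.
- apply: continuous_compact_integrable; first exact: segment_compact.
  exact: continuous_subspaceT.
- lra.
by move=> dF <-; rewrite derive1E; exact/derivableP.
Qed.

(** The primitive of f vanishing at m, made constant outside [m - r, m + r].
    Freezing it there keeps it continuous on the whole line while the bound
    [prim_dist] holds at every point, so that Picard iterates never have to be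
    restricted to an interval.  The integral starts at m - r - 1, so that m - r
    is an interior point of the domain of integration and differentiability
    holds there too. *)
Definition prim f s := F f (clamp m r s) - F f m.

Lemma prim_center f : prim f m = 0.
Proof. by rewrite /prim clampK ?subrr//; move: r_gt0 => r0; apply/andP; split; lra. Qed.

Lemma prim0 s : prim (fun=> 0) s = 0.
Proof.
by rewrite /prim /F /Rintegral !integral0 subrr.
Qed.

Lemma is_derive_prim f s : continuous f -> s \in `]m - r, m + r[ ->
  is_derive s 1 (prim f) (f s).
Proof.
move=> cf sI; have := sI; rewrite in_itv/= => /andP[ms sm].
apply: (@near_eq_is_derive _ _ _ (F f - cst (F f m))).
  have : \near s, s \in `]m - r, m + r[ by exact: near_in_itvoo.
  apply: filterS => x; rewrite in_itv/= => /andP[mx xm].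
  by rewrite /prim clampK ?(ltW mx) ?(ltW xm).
have := F_derive cf (ltW ms) => ?.
by apply: is_derive_eq; rewrite subr0.
Qed.

Lemma continuous_prim f : continuous f -> continuous (prim f).
Proof.
move=> cf s; apply: cvgB; last exact: cvg_cst.
apply: continuous_comp; first exact: continuous_clamp.
have /andP[h _] := @clamp_in _ m r s (ltW r_gt0).
have [d _] := F_derive cf h.
exact/differentiable_continuous/derivable1_diffP.
Qed.

(** Mean value inequality for the primitive of f - g, between m and the clamped
    point, which are at distance at most r. *)
Lemma prim_dist f g e s : continuous f -> continuous g ->
  (forall t, `|f t - g t| <= e) -> `|prim f s - prim g s| <= r * e.
Proof.
move=> cf cg fg; have e0 : 0 <= e by apply: le_trans (fg 0).
set h := F f - F g.
have -> : prim f s - prim g s = h (clamp m r s) - h m.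
  by rewrite /h /prim !fctE; ring.
have dh x : m - r <= x -> is_derive x 1 h (f x - g x).
  by move=> mx; have := F_derive cf mx; have := F_derive cg mx => ? ?; exact: is_deriveB.
have main x y : m - r <= x -> x <= y -> y - x <= r -> `|h y - h x| <= r * e.
  move=> mx xy yx.
  have [||z _ ->] := @MVT_segment R h (fun t => f t - g t) x y xy.
  - move=> t; rewrite in_itv/= => /andP[xt _]; apply: dh; lra.
  - apply: derivable_within_continuous => t; rewrite in_itv/= => /andP[xt _].
    by have [] : is_derive t 1 h (f t - g t) by apply: dh; lra.
  by rewrite normrM mulrC ler_pM// ger0_norm// subr_ge0.
have /andP[c1 c2] := @clamp_in _ m r s (ltW r_gt0).
have [cm|mc] := leP (clamp m r s) m; first by rewrite distrC; apply: main; lra.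
by apply: main; lra.
Qed.

End primitive.

(** * Geometric convergence *)

(** The intervals [u k - 2 B / 2^k, u k + 2 B / 2^k] are nested; the supremum of
    their left ends lies in all of them. *)
Lemma geometric_steps_limit {R : realType} (u : nat -> R) (B : R) :
  (forall k, `|u k.+1 - u k| <= B / 2 ^+ k) ->
  exists l, forall k, `|l - u k| <= 2 * B / 2 ^+ k.
Proof.
move=> du; have B0 : 0 <= B.
  by have := du 0%N; rewrite expr0 divr1; apply: le_trans.
pose e k : R := 2 * B / 2 ^+ k.
have eS k : e k = e k.+1 + B / 2 ^+ k.
  by rewrite /e exprS; field; exact: lt0r_neq0 (exprn_gt0 _ _).
have e0 k : 0 <= e k by rewrite divr_ge0 ?mulr_ge0// exprn_ge0.
have lo : {homo (fun k => u k - e k) : i j / (i <= j)%N >-> i <= j}.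
  apply: homo_leq => [//|? ? ?|k]; first exact: le_trans.
  by have := du k; rewrite ler_norml (eS k) => /andP[? ?]; lra.
have hi : {homo (fun k => - (u k + e k)) : i j / (i <= j)%N >-> i <= j}.
  apply: homo_leq => [//|? ? ?|k]; first exact: le_trans.
  by have := du k; rewrite ler_norml (eS k) => /andP[? ?]; lra.
have lohi i j : u i - e i <= u j + e j.
  have := lo _ _ (leq_maxl i j); have := hi _ _ (leq_maxr i j).
  by have := e0 (maxn i j); lra.
have ub k : ubound (range (fun i => u i - e i)) (u k + e k).
  by move=> _ [i _ <-].
exists (sup (range (fun i => u i - e i))) => k; rewrite -/(e k) ler_norml.
have l1 : u k - e k <= sup (range (fun i => u i - e i)).
  by apply: ub_le_sup; [exists (u k + e k); exact: ub|exists k].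
have l2 : sup (range (fun i => u i - e i)) <= u k + e k.
  by apply: ge_sup; [exists (u k - e k); exists k|exact: ub].
lra.
Qed.

Lemma cvg_div_pow2 {R : realType} (B : R) : (fun k => B / 2 ^+ k) @ \oo --> 0.
Proof.
have : geometric B (2^-1) @ \oo --> (0 : R).
  by apply: cvg_geometric; rewrite ger0_norm; lra.
by apply: cvg_trans; apply: near_eq_cvg; apply: nearW => k; rewrite /= exprVn.
Qed.

Lemma geometric_le_eq {R : realType} (x y B : R) :
  (forall k, `|x - y| <= B / 2 ^+ k) -> x = y.
Proof.
move=> xy; apply/eqP; rewrite -subr_eq0 -normr_le0.
apply: (@ler_cvg_to _ \oo _ _ (cst `|x - y|) _ _ _ _ (cvg_div_pow2 B)).
  exact: cvg_cst.
exact: nearW.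
Qed.

Lemma uniform_geometric_continuous {R : realType} (u : nat -> R -> R)
    (f : R -> R) (B : R) :
  (forall k, continuous (u k)) -> (forall k s, `|f s - u k s| <= B / 2 ^+ k) ->
  continuous f.
Proof.
move=> cu fu s; apply/cvgrPdist_le => e e0.
have [k ke] : exists k, B / 2 ^+ k <= e / 3.
  have /cvgr_lt/(_ (e / 3)) := cvg_div_pow2 B.
  rewrite divr_gt0// => /(_ isT) [k _ /(_ k (leqnn k))/= /ltW]; by exists k.
have {}cu : (e / 3 : R) > 0 -> \forall t \near s, `|u k s - u k t| <= e / 3.
  by move=> ?; move/cvgrPdist_le: (cu k s); exact.
near=> t; have ut : `|u k s - u k t| <= e / 3 by near: t; apply: cu; lra.
have := fu k s; have := fu k t; move: ut (ke).
rewrite !ler_norml => /andP[? ?] ? /andP[? ?] /andP[? ?].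
by apply/andP; split; lra.
Unshelve. all: by end_near. Qed.

(** * Calculus of matrix-valued functions *)

Lemma is_derive_mxP {R : realType} {p q : nat} (M : R -> 'M[R]_(p, q))
    (D : 'M[R]_(p, q)) (s : R) :
  is_derive s 1 M D <-> forall i j, is_derive s 1 (fun t => M t i j) (D i j).
Proof.
split=> [[dM <-] i j|dM].
  by rewrite derive_mx// mxE; apply/derivableP; exact: (derivable_mxP _ _ _).1.
have dM' : derivable M s 1 by apply/derivable_mxP => i j; have [] := dM i j.
split=> //; rewrite derive_mx//; apply/matrixP => i j; rewrite mxE.
by have [] := dM i j.
Qed.

(** * Linear differential equations *)

Section linear_ode.
Context {R : realType} {n : nat}.
Variables (m r K : R) (A : R -> 'M[R]_n) (X0 : 'M[R]_n).
Hypotheses (r_gt0 : 0 < r)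
  (cA : forall i j, continuous (fun s => A s i j))
  (A_le : forall s i j, `|A s i j| <= K)
  (rK : r * (n%:R * K) <= 2^-1).
Implicit Types X Y : R -> 'M[R]_n.

Let entries_continuous X := forall i j, continuous (fun s => X s i j).

Let picard X s : 'M[R]_n :=
  \matrix_(i, j) (X0 i j + prim m r (fun t => (A t *m X t) i j) s).

Let continuous_AX X : entries_continuous X -> 
  entries_continuous (fun s => A s *m X s).
Proof.
move=> cX i j; under eq_fun do rewrite mxE.
apply: continuous_big => [|k _]; first exact: add_continuous.
by move=> s; apply: cvgM; [exact: cA|exact: cX].
Qed.

Let continuous_picard X : entries_continuous X -> entries_continuous (picard X).
Proof.
move=> cX i j; under eq_fun do rewrite mxE.
move=> s; apply: cvgD; first exact: cvg_cst.
by apply: continuous_prim => //; exact: continuous_AX.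
Qed.

(* Each entry of A (X - Y) is a sum of n terms bounded by K e; integrating over
   a length r costs the factor r, and r n K <= 1/2. *)
Let picard_dist X Y e : entries_continuous X -> entries_continuous Y ->
  (forall s i j, `|X s i j - Y s i j| <= e) ->
  forall s i j, `|picard X s i j - picard Y s i j| <= e / 2.
Proof.
move=> cX cY XY s i j; have e0 : 0 <= e by apply: le_trans (XY 0 i j).
rewrite !mxE opprD addrACA subrr add0r.
apply: (@le_trans _ _ (r * (n%:R * K * e))); last first.
  by rewrite mulrA (mulrC e) ler_wpM2r.
apply: prim_dist => //; [exact: continuous_AX..|move=> t].
rewrite !mxE -sumrB (le_trans (ler_norm_sum _ _ _))//.
apply: (@le_trans _ _ (\sum_(k < n) K * e)).
  by apply: ler_sum => k _; rewrite -mulrBr normrM ler_pM.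
by rewrite sumr_const card_ord -mulrA mulr_natl.
Qed.

(** Picard-Lindeloef for a linear equation, on an interval short enough for the
    Picard operator to halve distances.  The iterates start from the zero
    function, so that the first step has the size of the constant X0. *)
Lemma linear_ode : exists X, [/\ X m = X0,
  forall i j, continuous (fun s => X s i j) &
  forall s, s \in `]m - r, m + r[ -> is_derive s 1 X (A s *m X s)].
Proof.
pose u k := iter k picard (fun=> 0).
have cu k : entries_continuous (u k).
  elim: k => [|k IH]; last exact: continuous_picard.
  by move=> i j; under eq_fun do rewrite mxE; exact: cst_continuous.
pose B := \sum_i \sum_j `|X0 i j|.
have du k : forall s i j, `|u k.+1 s i j - u k s i j| <= B / 2 ^+ k.
  elim: k => [|k IH] s i j.
    rewrite expr0 divr1 !mxE; under eq_fun do rewrite mulmx0 mxE.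
    rewrite prim0 addr0 subr0 /B (bigD1 i)//= (bigD1 j)//= -addrA lerDl.
    by rewrite addr_ge0// sumr_ge0// => ? _; exact: sumr_ge0.
  by rewrite exprSr invfM mulrA; exact: (picard_dist (cu k.+1) (cu k)).
have Xex : forall sij : R * 'I_n * 'I_n, exists l, forall k,
    `|l - u k sij.1.1 sij.1.2 sij.2| <= 2 * B / 2 ^+ k.
  move=> [[s i] j] /=; apply: (@geometric_steps_limit _ (fun k => u k s i j)).
  by move=> k; exact: du.
have [X' X'u] := choice Xex.
pose X s : 'M[R]_n := \matrix_(i, j) X' (s, i, j).
have Xu k s i j : `|X s i j - u k s i j| <= 2 * B / 2 ^+ k.
  by rewrite mxE; exact: (X'u (s, i, j)).
have cX : entries_continuous X.
  move=> i j; apply: (@uniform_geometric_continuous _ (fun k s => u k s i j) _ (2 * B)).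
    by move=> k; exact: cu.
  by move=> k s; exact: Xu.
have XE s : X s = picard X s.
  apply/matrixP => i j; apply: (@geometric_le_eq _ _ _ (2 * B)) => k.
  rewrite -(subrKA (u k.+1 s i j)) (le_trans (ler_normD _ _))//.
  have h1 := Xu k.+1 s i j.
  have h2 : `|u k.+1 s i j - picard X s i j| <= 2 * B / 2 ^+ k / 2.
    by apply: picard_dist => // t a b; rewrite distrC.
  by move: h1; rewrite exprSr invfM mulrA => h1; lra.
exists X; split=> //.
  by rewrite XE; apply/matrixP => i j; rewrite mxE prim_center// addr0.
move=> s sI.
apply/is_derive_mxP => i j.
have -> : (fun t => X t i j) = cst (X0 i j) + prim m r (fun t => (A t *m X t) i j).
  by apply/funext => t; rewrite XE mxE.
have ? := is_derive_prim (@continuous_AX X cX i j) sI.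
by apply: is_derive_eq; rewrite add0r.
Qed.

End linear_ode.

(** * Products, constancy and skew-symmetric systems *)

Section matrix_calculus.
Context {R : realType}.

Lemma is_derive_mulmx p q l (F : R -> 'M[R]_(p, q)) (G : R -> 'M[R]_(q, l))
    dF dG (s : R) :
  is_derive s 1 F dF -> is_derive s 1 G dG ->
  is_derive s 1 (fun t => F t *m G t) (dF *m G s + F s *m dG).
Proof.
move=> /is_derive_mxP hF /is_derive_mxP hG; apply/is_derive_mxP => i j.
have -> : (fun t => (F t *m G t) i j) =
    \sum_(k < q) ((fun t => F t i k) * (fun t => G t k j)).
  by apply/funext => t; rewrite mxE fct_sumE.
have -> : (dF *m G s + F s *m dG) i j =
    \sum_(k < q) (F s i k *: dG k j + G s k j *: dF i k).
  rewrite !mxE -big_split/=; apply: eq_bigr => k _.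
  by rewrite addrC; congr (_ + _); rewrite mulrC.
by apply: is_derive_sum => k; apply: is_deriveM.
Qed.

Lemma is_derive_trmx p q (F : R -> 'M[R]_(p, q)) dF (s : R) :
  is_derive s 1 F dF -> is_derive s 1 (fun t => (F t)^T) dF^T.
Proof.
move=> /is_derive_mxP hF; apply/is_derive_mxP => i j.
by under eq_fun do rewrite mxE; rewrite mxE.
Qed.

Lemma is_derive0_constant (f : R -> R) (c d x y : R) :
  (forall s, s \in `]c, d[ -> is_derive s 1 f 0) ->
  x \in `]c, d[ -> y \in `]c, d[ -> f x = f y.
Proof.
move=> df; wlog xy : x y / x <= y.
  by move=> H xI yI; case: (leP x y) => [|/ltW] ?; [|apply/esym]; exact: H.
rewrite !in_itv/= => /andP[cx _] /andP[_ yd].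
have sub s : x <= s -> s <= y -> is_derive s 1 f 0.
  by move=> xs sy; apply: df; rewrite in_itv/= (lt_le_trans cx)// (le_lt_trans sy).
have dxy s : s \in `]x, y[ -> is_derive s 1 f 0.
  by rewrite in_itv/= => /andP[xs sy]; exact: (sub s (ltW xs) (ltW sy)).
have cf : {within `[x, y], continuous f}.
  apply: derivable_within_continuous => s; rewrite in_itv/= => /andP[xs sy].
  by have [] := sub s xs sy.
have [z _ fE] := @MVT_segment R f (fun=> 0) x y xy dxy cf.
by move/eqP: fE; rewrite mul0r subr_eq0 => /eqP ->.
Qed.

Lemma is_derive0_constant_mx p q (F : R -> 'M[R]_(p, q)) (c d x y : R) :
  (forall s, s \in `]c, d[ -> is_derive s 1 F 0) ->
  x \in `]c, d[ -> y \in `]c, d[ -> F x = F y.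
Proof.
move=> dF xI yI; apply/matrixP => i j.
apply: (@is_derive0_constant (fun t => F t i j) c d) => // s /dF /is_derive_mxP.
by move=> /(_ i j); rewrite mxE.
Qed.

(** (G^T F)' = G^T (A^T + A) F = 0.  With G = F this says that orthogonality is
    preserved; with two frames it says that the rotation between them is
    constant. *)
Lemma skew_ode_gram_constant n (A F G : R -> 'M[R]_n) (c d x y : R) :
  (forall s, s \in `]c, d[ -> (A s)^T = - A s) ->
  (forall s, s \in `]c, d[ -> is_derive s 1 F (A s *m F s)) ->
  (forall s, s \in `]c, d[ -> is_derive s 1 G (A s *m G s)) ->
  x \in `]c, d[ -> y \in `]c, d[ ->
  (G x)^T *m F x = (G y)^T *m F y.
Proof.
move=> skewA dF dG.
apply: (@is_derive0_constant_mx _ _ (fun s => (G s)^T *m F s)) => s sI.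
have := is_derive_mulmx (is_derive_trmx (dG s sI)) (dF s sI).
by rewrite trmx_mul skewA// mulmxN mulNmx mulmxA addNr.
Qed.

Lemma eq_near_itvoo {T : Type} (f g : R -> T) (c d s : R) :
  (forall t, t \in `]c, d[ -> f t = g t) -> s \in `]c, d[ ->
  \near s, f s = g s.
Proof. by move=> fg sI; apply: filterS (near_in_itvoo sI). Qed.

End matrix_calculus.

(** * Vectors and triads in space *)

Section space_vectors.
Context {R : realType}.
Implicit Types u v w : 'cV[R]_3.

Lemma sum3 {V : zmodType} (F : 'I_3 -> V) : \sum_(i < 3) F i = F 0 + F 1 + F 2%:R.
Proof.
by rewrite !big_ord_recl big_ord0 addr0 addrA; congr (F _ + F _ + F _); exact: val_inj.
Qed.

Lemma ord3_ind (P : 'I_3 -> Prop) : P 0 -> P 1 -> P 2%:R -> forall i, P i.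
Proof.
move=> P0 P1 P2 [[|[|[|//]]] i]; [move: P0|move: P1|move: P2];
  by congr P; exact: val_inj.
Qed.

Lemma dotvE u v : dotv u v = u 0 0 * v 0 0 + u 1 0 * v 1 0 + u 2%:R 0 * v 2%:R 0.
Proof. by rewrite /dotv sum3. Qed.

Lemma crossvE u v : [/\ crossv u v 0 0 = u 1 0 * v 2%:R 0 - u 2%:R 0 * v 1 0,
  crossv u v 1 0 = u 2%:R 0 * v 0 0 - u 0 0 * v 2%:R 0 &
  crossv u v 2%:R 0 = u 0 0 * v 1 0 - u 1 0 * v 0 0].
Proof.
split; rewrite mxE ?add0r //.
- have -> : 1 + 1 = 2%:R :> 'I_3 by exact: val_inj.
  by have -> : 1 + 2%:R = 0 :> 'I_3 by exact: val_inj.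
- have -> : 2%:R + 1 = 0 :> 'I_3 by exact: val_inj.
  by have -> : 2%:R + 2%:R = 1 :> 'I_3 by exact: val_inj.
Qed.

Definition rows3 u v w : 'M[R]_3 := \matrix_(i, j) ([:: u; v; w]`_i) j 0.

(** The coefficients of the Frenet equations for a frame stored by rows. *)
Definition frenet_mx (k t : R) : 'M[R]_3 :=
  \matrix_(i, j) (nth [::] [:: [:: 0; k; 0]; [:: - k; 0; t]; [:: 0; - t; 0]] i)`_j.

Lemma det3 (A : 'M[R]_3) : \det A =
  A 0 0 * (A 1 1 * A 2%:R 2%:R - A 1 2%:R * A 2%:R 1)
  - A 0 1 * (A 1 0 * A 2%:R 2%:R - A 1 2%:R * A 2%:R 0)
  + A 0 2%:R * (A 1 0 * A 2%:R 1 - A 1 1 * A 2%:R 0).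
Proof.
(* Indexing by nat lets the row and column indices produced by the nested
   cofactor expansions compute. *)
pose a i j := A (inord i) (inord j).
have aE (i j : 'I_3) : A i j = a i j by rewrite /a !inord_val.
rewrite !aE.
rewrite (expand_det_row _ 0) sum3 /cofactor.
rewrite !(expand_det_row _ 0) !big_ord_recl !big_ord0 /cofactor !det_mx11 !mxE !aE /=.
rewrite /bump /=. ring.
Qed.


Lemma skew_frenet_mx (k t : R) : (frenet_mx k t)^T = - frenet_mx k t.
Proof.
by apply/matrixP => i j; rewrite !mxE;
  elim/ord3_ind: i; elim/ord3_ind: j; rewrite /= ?oppr0 ?opprK.
Qed.

Lemma frenet_mx_rows3 (k t : R) u v w :
  frenet_mx k t *m rows3 u v w = rows3 (k *: v) (- k *: u + t *: w) (- t *: v).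
Proof.
by apply/matrixP => i j; rewrite mxE sum3 !mxE; elim/ord3_ind: i; rewrite /= !mxE; ring.
Qed.

Lemma is_derive_rows3 (u v w : R -> 'cV[R]_3) du dv dw (s : R) :
  is_derive s 1 (fun t => rows3 (u t) (v t) (w t)) (rows3 du dv dw) <->
  [/\ is_derive s 1 u du, is_derive s 1 v dv & is_derive s 1 w dw].
Proof.
have E k i : (fun t => rows3 (u t) (v t) (w t) k i) =
    (fun t => ([:: u t; v t; w t]`_k) i 0) by apply/funext => t; rewrite mxE.
split=> [/is_derive_mxP h|[/is_derive_mxP hu /is_derive_mxP hv /is_derive_mxP hw]].
  split; apply/is_derive_mxP => i j; rewrite (ord1 j).
  - by move: (h 0 i); rewrite E mxE.
  - by move: (h 1 i); rewrite E mxE.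
  - by move: (h 2%:R i); rewrite E mxE.
by apply/is_derive_mxP => i j; rewrite E mxE; elim/ord3_ind: i => /=.
Qed.

Lemma rows3_tr (F : 'M[R]_3) :
  F = rows3 (row 0 F)^T (row 1 F)^T (row 2%:R F)^T.
Proof.
by apply/matrixP => i j; rewrite !mxE; elim/ord3_ind: i; rewrite /= !mxE.
Qed.

Lemma rows3_gram u v w i j : (rows3 u v w *m (rows3 u v w)^T) i j =
  dotv ([:: u; v; w]`_i) ([:: u; v; w]`_j).
Proof. by rewrite mxE; apply: eq_bigr => k _; rewrite !mxE. Qed.

Lemma det_rows3 u v w : \det (rows3 u v w) = dotv w (crossv u v).
Proof.
have [c0 c1 c2] := crossvE u v.
by rewrite det3 dotvE c0 c1 c2 !mxE/=; ring.
Qed.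

Lemma dotvC u v : dotv u v = dotv v u.
Proof. by apply: eq_bigr => i _; rewrite mulrC. Qed.

Lemma dotvZ (a b : R) u v : dotv (a *: u) (b *: v) = a * b * dotv u v.
Proof. by rewrite !dotvE !mxE; ring. Qed.

(** Lagrange's identity |u x v|^2 = |u|^2 |v|^2 - (u . v)^2 gives the length of
    the third vector, and also the determinant, which is |u x v|^2. *)
Lemma orthonormal_rows3 u v : dotv u u = 1 -> dotv v v = 1 -> dotv u v = 0 ->
  rows3 u v (crossv u v) *m (rows3 u v (crossv u v))^T = 1%:M /\
  \det (rows3 u v (crossv u v)) = 1.
Proof.
move=> uu vv uv; have [c0 c1 c2] := crossvE u v.
have ww : dotv (crossv u v) (crossv u v) = 1.
  rewrite -[RHS](_ : dotv u u * dotv v v - dotv u v ^+ 2 = 1); last first.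
    by rewrite uu vv uv; ring.
  by rewrite !dotvE c0 c1 c2; ring.
have uw : dotv u (crossv u v) = 0 by rewrite !dotvE c0 c1 c2; ring.
have vw : dotv v (crossv u v) = 0 by rewrite !dotvE c0 c1 c2; ring.
split; last by rewrite det_rows3.
have gramC (x y : 'cV[R]_3) : dotv x y = 0 -> dotv y x = 0 by rewrite dotvC.
apply/matrixP => i j; rewrite rows3_gram mxE.
by elim/ord3_ind: i; elim/ord3_ind: j => //=; exact: gramC.
Qed.

(** Both w and u x v have coordinates (0, 0, 1) in the basis u, v, w; for u x v
    the last coordinate is the determinant.  This is where the orientation of
    the triad is used. *)
Lemma orthonormal_det_crossv u v w :
  (rows3 u v w)^T *m rows3 u v w = 1%:M -> \det (rows3 u v w) = 1 ->
  [/\ dotv u u = 1, dotv v v = 1 & w = crossv u v].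
Proof.
set F := rows3 u v w => FF dF; have FF' := mulmx1C FF.
split.
- by rewrite -[LHS](rows3_gram u v w 0 0) FF' mxE.
- by rewrite -[LHS](rows3_gram u v w 1 1) FF' mxE.
have [c0 c1 c2] := crossvE u v.
have gram i : (F *m w) i 0 = (i == 2%:R)%:R.
  have := rows3_gram u v w i 2%:R; rewrite FF' !mxE => ->.
  by apply: eq_bigr => k _; rewrite mxE.
have Fc : F *m w = F *m crossv u v.
  apply/matrixP => i j; rewrite (ord1 j) gram mxE.
  have -> : \sum_k F i k * crossv u v k 0 = dotv ([:: u; v; w]`_i) (crossv u v).
    by apply: eq_bigr => k _; rewrite mxE.
  elim/ord3_ind: i => /=; rewrite ?dotvE ?c0 ?c1 ?c2; [ring|ring|].
  by rewrite -c0 -c1 -c2 -dotvE -det_rows3 dF.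
by rewrite -[w]mul1mx -FF -mulmxA Fc mulmxA FF mul1mx.
Qed.

Lemma is_derive_dotv (u v : R -> 'cV[R]_3) du dv (s : R) :
  is_derive s 1 u du -> is_derive s 1 v dv ->
  is_derive s 1 (fun t => dotv (u t) (v t)) (dotv du (v s) + dotv (u s) dv).
Proof.
move=> /is_derive_mxP hu /is_derive_mxP hv.
have -> : (fun t => dotv (u t) (v t)) =
   \sum_(k < 3) ((fun t => u t k 0) * (fun t => v t k 0)).
  by apply/funext => t; rewrite fct_sumE.
have -> : dotv du (v s) + dotv (u s) dv =
    \sum_(k < 3) (u s k 0 *: dv k 0 + v s k 0 *: du k 0).
  rewrite -big_split/=; apply: eq_bigr => k _.
  by rewrite addrC; congr (_ + _); rewrite mulrC.
by apply: is_derive_sum => k; apply: is_deriveM.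
Qed.

Lemma is_derive_crossv (u v : R -> 'cV[R]_3) du dv (s : R) :
  is_derive s 1 u du -> is_derive s 1 v dv ->
  is_derive s 1 (fun t => crossv (u t) (v t)) (crossv du (v s) + crossv (u s) dv).
Proof.
move=> /is_derive_mxP hu /is_derive_mxP hv; apply/is_derive_mxP => i j.
have -> : (fun t => crossv (u t) (v t) i j) =
   (fun t => u t (i + 1) 0) * (fun t => v t (i + 2%:R) 0) -
   (fun t => u t (i + 2%:R) 0) * (fun t => v t (i + 1) 0).
  by apply/funext => t; rewrite mxE.
apply: is_derive_eq; rewrite !mxE /GRing.scale/=; ring.
Qed.

End space_vectors.

(** * The Frenet frame of a curve *)

Section curves.
Context {R : realType}.

Lemma dotv_ge0 (u : 'cV[R]_3) : 0 <= dotv u u.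
Proof. by apply: sumr_ge0 => i _; rewrite -expr2 sqr_ge0. Qed.

Lemma enorm_sqr (u : 'cV[R]_3) : enorm u ^+ 2 = dotv u u.
Proof. by rewrite sqr_sqrtr// dotv_ge0. Qed.

Lemma is_derive_derive1 (V : normedModType R) (f : R -> V) df (s : R) :
  is_derive s 1 f df -> derive1 f s = df.
Proof. by move=> [_ <-]; rewrite derive1E. Qed.

Lemma is_derive_scale p q (k : R -> R) (F : R -> 'M[R]_(p, q)) dk dF (s : R) :
  is_derive s 1 k dk -> is_derive s 1 F dF ->
  is_derive s 1 (fun t => k t *: F t) (dk *: F s + k s *: dF).
Proof.
move=> hk /is_derive_mxP hF; apply/is_derive_mxP => i j.
have -> : (fun t => (k t *: F t) i j) = k * (fun t => F t i j).
  by apply/funext => t; rewrite mxE.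
have ? := hF i j.
by apply: is_derive_eq; rewrite !mxE addrC [_ *: dk]mulrC.
Qed.

Definition frame (alpha : R -> 'cV[R]_3) (s : R) : 'M[R]_3 :=
  rows3 (tangent alpha s) (normal alpha s) (binormal alpha s).

Section frame_of_curve.
Variables (c d : R) (kappa tau : R -> R) (alpha : R -> 'cV[R]_3).
Hypothesis kappa_gt0 : forall s, s \in `]c, d[ -> 0 < kappa s.
Hypothesis alphaP : has_curvature_torsion `]c, d[ kappa tau alpha.

Lemma is_derive_curve s : s \in `]c, d[ -> is_derive s 1 alpha (tangent alpha s).
Proof.
move=> sI; have [h _ _ _ _] := alphaP.
by rewrite /tangent derive1E; apply/derivableP/(h s sI 0).
Qed.

Lemma is_derive_frame s : s \in `]c, d[ ->
  is_derive s 1 (frame alpha) (frenet_mx (kappa s) (tau s) *m frame alpha s).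
Proof.
move=> sI; have [_ _ _ hk ht] := alphaP; have [dt dn db] := ht s sI.
by rewrite frenet_mx_rows3 -hk//; apply/is_derive_rows3.
Qed.

(** The tangent is orthogonal to the normal because differentiating
    t . t = 1 gives 2 kappa (t . n) = 0, and kappa > 0. *)
Lemma frame_orthonormal s : s \in `]c, d[ ->
  frame alpha s *m (frame alpha s)^T = 1%:M /\ \det (frame alpha s) = 1.
Proof.
move=> sI; have [_ _ al hk ht] := alphaP; have k0 := kappa_gt0 sI.
have tt r : r \in `]c, d[ -> dotv (tangent alpha r) (tangent alpha r) = 1.
  by move=> rI; rewrite -enorm_sqr al// expr1n.
apply: orthonormal_rows3; first exact: tt.
  rewrite dotvZ -enorm_sqr -/(curvature _ _) hk//.
  by field; rewrite gt_eqF.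
have [dt _ _] := ht s sI; rewrite hk// in dt.
have d0 : is_derive s 1 (fun t => dotv (tangent alpha t) (tangent alpha t)) (0 : R).
  apply: near_eq_is_derive (is_derive_cst (1 : R) s 1).
  by apply: eq_near_itvoo sI => t tI; rewrite /= tt.
have := is_derive_derive1 (is_derive_dotv dt dt).
rewrite (is_derive_derive1 d0) (dotvC (_ *: _)) -mulr2n.
rewrite -[X in dotv X _]scale1r dotvZ mul1r => /esym/eqP.
by rewrite mulrn_eq0/= mulf_eq0 gt_eqF//= => /eqP.
Qed.

End frame_of_curve.

(** A curve whose velocity is the first row of an orthonormal solution of the
    Frenet system has this solution as its frame.  The identities between
    u, v, w and the tangent, normal, binormal hold on an open interval, hence
    near each of its points, and so pass to derivatives. *)
Lemma has_curvature_torsion_of_frame (c d : R) (kappa tau : R -> R)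
    (alpha u v w : R -> 'cV[R]_3) :
  (forall s, s \in `]c, d[ -> derivable kappa s 1) ->
  (forall s, s \in `]c, d[ -> 0 < kappa s) ->
  (forall s, s \in `]c, d[ -> is_derive s 1 alpha (u s)) ->
  (forall s, s \in `]c, d[ -> is_derive s 1 (fun t => rows3 (u t) (v t) (w t))
    (frenet_mx (kappa s) (tau s) *m rows3 (u s) (v s) (w s))) ->
  (forall s, s \in `]c, d[ -> [/\ dotv (u s) (u s) = 1, dotv (v s) (v s) = 1 &
    w s = crossv (u s) (v s)]) ->
  has_curvature_torsion `]c, d[ kappa tau alpha.
Proof.
move=> dk k0 da dF uvw.
have dF' s : s \in `]c, d[ -> [/\ is_derive s 1 u (kappa s *: v s),
    is_derive s 1 v (- kappa s *: u s + tau s *: w s) &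
    is_derive s 1 w (- tau s *: v s)].
  by move=> /dF; rewrite frenet_mx_rows3 => /is_derive_rows3.
have tE s : s \in `]c, d[ -> tangent alpha s = u s.
  by move=> sI; exact: is_derive_derive1 (da s sI).
have near_d (f g : R -> 'cV[R]_3) df s : (forall t, t \in `]c, d[ -> g t = f t) ->
    s \in `]c, d[ -> is_derive s 1 f df -> is_derive s 1 g df.
  move=> gf sI; apply: near_eq_is_derive.
  by apply: eq_near_itvoo sI => t tI; rewrite gf.
have dt s : s \in `]c, d[ -> is_derive s 1 (tangent alpha) (kappa s *: v s).
  by move=> sI; apply: (near_d u) => //; have [] := dF' s sI.
have a2E s : s \in `]c, d[ -> derive1n 2 alpha s = kappa s *: v s.
  by move=> sI; exact: is_derive_derive1 (dt s sI).
have kE s : s \in `]c, d[ -> curvature alpha s = kappa s.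
  move=> sI; have [_ vv _] := uvw s sI.
  rewrite /curvature a2E// /enorm dotvZ vv mulr1 -expr2 sqrtr_sqr.
  by rewrite ger0_norm// ltW// k0.
have nE s : s \in `]c, d[ -> normal alpha s = v s.
  move=> sI; rewrite /normal kE// a2E// scalerA mulVf ?scale1r//.
  by rewrite gt_eqF// k0.
have bE s : s \in `]c, d[ -> binormal alpha s = w s.
  by move=> sI; rewrite /binormal tE// nE//; have [_ _] := uvw s sI.
have al s : s \in `]c, d[ -> enorm (derive1 alpha s) = 1.
  move=> sI; rewrite -/(tangent alpha s) tE// /enorm.
  by have [-> _ _] := uvw s sI; rewrite sqrtr1.
split=> //.
- move=> s sI [|[|[|//]]] _.
  + by have [] := da s sI.
  + by have [] := dt s sI.
  + have [_ dv _] := dF' s sI.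
    have dkv := is_derive_scale (derivableP (dk s sI)) dv.
    by have [] := near_d _ (derive1n 2 alpha) _ s a2E sI dkv.
- move=> s sI; apply/eqP => a0; have := al s sI; rewrite a0 /enorm.
  rewrite dotvE !mxE !mul0r !addr0 sqrtr0 => /esym/eqP.
  by rewrite oner_eq0.
- move=> s sI; have [du dv dw] := dF' s sI.
  rewrite /is_torsion kE// tE// nE// bE//; split; first exact: dt.
    exact: near_d nE sI dv.
  exact: near_d bE sI dw.
Qed.

Lemma special_orthogonal_transition (F G : 'M[R]_3) :
  F *m F^T = 1%:M -> G *m G^T = 1%:M -> \det F = 1 -> \det G = 1 ->
  orthogonal_mx (G^T *m F) /\ 0 < \det (G^T *m F).
Proof.
move=> FF GG dF dG; split; last by rewrite det_mulmx det_tr dG dF mulr1 ltr01.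
rewrite /orthogonal_mx trmx_mul trmxK -mulmxA (mulmxA G) GG mul1mx.
exact: mulmx1C.
Qed.

(** The rotation between the two frames is constant by
    [skew_ode_gram_constant]; it maps alpha' to beta', so that it maps alpha to
    beta up to a translation. *)
Lemma curve_rigidity (c d : R) (kappa tau : R -> R) (alpha beta : R -> 'cV[R]_3) :
  c < d -> (forall s, s \in `]c, d[ -> 0 < kappa s) ->
  has_curvature_torsion `]c, d[ kappa tau alpha ->
  has_curvature_torsion `]c, d[ kappa tau beta ->
  exists (rho : 'M[R]_3) (v : 'cV[R]_3),
    [/\ orthogonal_mx rho, 0 < \det rho &
        forall s, s \in `]c, d[ -> beta s = rho *m alpha s + v].
Proof.
move=> cd k0 ha hb; pose m := (c + d) / 2.
have mI : m \in `]c, d[ by rewrite in_itv/= /m; apply/andP; split; lra.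
pose rho := (frame beta m)^T *m frame alpha m.
have rhoE s : s \in `]c, d[ -> rho = (frame beta s)^T *m frame alpha s.
  move=> sI; pose A s := frenet_mx (kappa s) (tau s).
  apply: (skew_ode_gram_constant (A := A) _ _ _ mI sI).
  - by move=> t _; exact: skew_frenet_mx.
  - by move=> t; exact: is_derive_frame.
  - by move=> t; exact: is_derive_frame.
have [aa da] := frame_orthonormal k0 ha mI.
have [bb db] := frame_orthonormal k0 hb mI.
have [orho drho] := special_orthogonal_transition aa bb da db.
exists rho, (beta m - rho *m alpha m); split=> //.
move=> s sI.
suff : beta s - rho *m alpha s = beta m - rho *m alpha m.
  by move=> <-; rewrite addrC subrK.
apply: (@is_derive0_constant_mx _ _ _ (fun t => beta t - rho *m alpha t) c d) => // t tI.
have -> : 0 = tangent beta t - (0 *m alpha t + rho *m tangent alpha t).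
  have [aat _] := frame_orthonormal k0 ha tI.
  rewrite mul0mx add0r; apply/esym/eqP; rewrite subr_eq0; apply/eqP.
  have row_tr (f : R -> 'cV[R]_3) : (frame f t)^T *m delta_mx 0 0 = tangent f t.
    by rewrite -colE; apply/matrixP => i j; rewrite !mxE (ord1 j).
  rewrite -!row_tr mulmxA (rhoE t tI) -(mulmxA _ (frame alpha t)).
  by rewrite aat mulmx1.
have dbeta := is_derive_curve hb tI; have dalpha := is_derive_curve ha tI.
have rho' : is_derive t 1 (fun=> rho) 0 by exact: is_derive_cst.
exact: is_deriveB dbeta (is_derive_mulmx rho' dalpha).
Qed.

End curves.

(** * Solving the Frenet system *)

Section existence.
Context {R : realType}.

(** The derivative of the triple product w . (u x v) along the Frenet system. *)
Lemma triple_product_frenet0 (k t : R) (u v w : 'cV[R]_3) :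
  dotv (- t *: v) (crossv u v) +
  dotv w (crossv (k *: v) v + crossv u (- k *: u + t *: w)) = 0.
Proof.
have [a0 a1 a2] := crossvE u v; have [b0 b1 b2] := crossvE (k *: v) v.
have [c0 c1 c2] := crossvE u (- k *: u + t *: w).
have addE (x y : 'cV[R]_3) i : (x + y) i 0 = x i 0 + y i 0 by rewrite mxE.
have scaleE z (x : 'cV[R]_3) i : (z *: x) i 0 = z * x i 0 by rewrite mxE.
rewrite !dotvE !addE a0 a1 a2 b0 b1 b2 c0 c1 c2 !addE !scaleE; ring.
Qed.

Lemma frenet_ode_det_constant (k t : R -> R) (u v w : R -> 'cV[R]_3) (c d x y : R) :
  (forall s, s \in `]c, d[ -> is_derive s 1 (fun t => rows3 (u t) (v t) (w t))
    (frenet_mx (k s) (t s) *m rows3 (u s) (v s) (w s))) ->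
  x \in `]c, d[ -> y \in `]c, d[ ->
  \det (rows3 (u x) (v x) (w x)) = \det (rows3 (u y) (v y) (w y)).
Proof.
move=> dF xI yI; rewrite !det_rows3.
apply: (@is_derive0_constant _ (fun s => dotv (w s) (crossv (u s) (v s))) c d) => // s.
move=> /dF; rewrite frenet_mx_rows3 => /is_derive_rows3[du dv dw].
apply: is_derive_eq; first exact: is_derive_dotv dw (is_derive_crossv du dv).
exact: triple_product_frenet0.
Qed.

(** The radius and the bound asked by [linear_ode] in dimension 3. *)
Lemma locally_bounded_frenet (a b m : R) (kappa tau : R -> R) :
  m \in `]a, b[ -> {for m, continuous kappa} -> {for m, continuous tau} ->
  exists r K : R, [/\ 0 < r, r * (3%:R * K) <= 2^-1 &
    forall s, m - r <= s <= m + r ->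
      [/\ s \in `]a, b[, `|kappa s| <= K & `|tau s| <= K]].
Proof.
move=> mI ck ct; pose K := `|kappa m| + `|tau m| + 1.
have K1 : 1 <= K by rewrite lerDr addr_ge0.
have : \forall s \near m, [/\ s \in `]a, b[, `|kappa s| <= K & `|tau s| <= K].
  have bd (f : R -> R) : {for m, continuous f} -> `|f m| < K ->
      \forall s \near m, `|f s| <= K.
    by move=> cf fK; exact: (@cvgr_norm_le _ R^o _ _ _ f (f m) cf).
  near=> s; split; near: s.
  - exact: near_in_itvoo.
  - by apply: bd => //; rewrite /K; have := normr_ge0 (tau m); lra.
  - by apply: bd => //; rewrite /K; have := normr_ge0 (kappa m); lra.
move=> /nbhs_ballP[e/= e0 he].
(* Halving e puts the closed interval inside the open ball; the factor
   6 = 2 * 3 makes r * (3 * K) at most 1/2. *)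
exists (Num.min (e / 2) (6 * K)^-1), K.
have i0 : 0 < (6 * K)^-1 by rewrite invr_gt0; lra.
have r1 : Num.min (e / 2) (6 * K)^-1 <= e / 2 by rewrite ge_min lexx.
have r2 : Num.min (e / 2) (6 * K)^-1 <= (6 * K)^-1 by rewrite ge_min lexx orbT.
split.
- by rewrite lt_min i0 divr_gt0.
- apply: (@le_trans _ _ ((6 * K)^-1 * (3 * K))).
    by rewrite ler_wpM2r//; lra.
  by rewrite [leLHS](_ : _ = 2^-1)//; field; lra.
- move=> s /andP[ms sm]; apply: he.
  by rewrite /ball/= ltr_norml; apply/andP; split; lra.
Unshelve. all: by end_near. Qed.

(** The continuity of u is claimed on the whole line, so that [prim] applies to
    u; the coefficients are extended to the line by freezing them outside
    [m - r, m + r]. *)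
Lemma frenet_frame_exists (a b m : R) (kappa tau : R -> R) :
  m \in `]a, b[ ->
  (forall s, s \in `]a, b[ -> {for s, continuous kappa}) ->
  (forall s, s \in `]a, b[ -> {for s, continuous tau}) ->
  exists r (u v w : R -> 'cV[R]_3), [/\ 0 < r,
    forall s, s \in `]m - r, m + r[ -> s \in `]a, b[,
    forall i, continuous (fun s => u s i 0),
    forall s, s \in `]m - r, m + r[ ->
      is_derive s 1 (fun t => rows3 (u t) (v t) (w t))
        (frenet_mx (kappa s) (tau s) *m rows3 (u s) (v s) (w s)) &
    forall s, s \in `]m - r, m + r[ -> [/\ dotv (u s) (u s) = 1,
      dotv (v s) (v s) = 1 & w s = crossv (u s) (v s)]].
Proof.
move=> mI ck ct.
have [r [K [r0 rK hK]]] := locally_bounded_frenet mI (ck m mI) (ct m mI).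
have K0 : 0 <= K.
  have [|_ + _] := hK m; first by apply/andP; split; lra.
  exact: le_trans.
have cl s : m - r <= clamp m r s <= m + r by apply: clamp_in; exact: ltW.
pose A s := frenet_mx (kappa (clamp m r s)) (tau (clamp m r s)).
have cA i j : continuous (fun s => A s i j).
  have cc (f : R -> R) : (forall s, s \in `]a, b[ -> {for s, continuous f}) ->
      continuous (fun s => f (clamp m r s)).
    move=> cf s; apply: continuous_comp; first exact: continuous_clamp.
    by apply: cf; have [] := hK _ (cl s).
  have cN (f : R -> R) : continuous f -> continuous (fun s => - f s).
    by move=> cf s; apply: cvgN; exact: cf.
  have -> : (fun s => A s i j) = (fun s => (nth [::] [:: [:: 0; kappa (clamp m r s); 0];
    [:: - kappa (clamp m r s); 0; tau (clamp m r s)]; [:: 0; - tau (clamp m r s); 0]] i)`_j).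
    by apply/funext => s; rewrite mxE.
  elim/ord3_ind: i; elim/ord3_ind: j => /=; try exact: cst_continuous;
    solve [exact: cc | by apply: cN; exact: cc].
have A_le s i j : `|A s i j| <= K.
  have [_ kK tK] := hK _ (cl s).
  by rewrite mxE; elim/ord3_ind: i; elim/ord3_ind: j; rewrite /= ?normr0 ?normrN.
have [F [Fm cF dF]] := linear_ode m 1%:M r0 cA A_le rK.
have mJ : m \in `]m - r, m + r[ by rewrite in_itv/=; apply/andP; split; lra.
pose f k s : 'cV[R]_3 := (row k (F s))^T.
have FE : F = fun s => rows3 (f 0 s) (f 1 s) (f 2%:R s).
  by apply/funext => s; exact: rows3_tr.
have AE s : s \in `]m - r, m + r[ -> A s = frenet_mx (kappa s) (tau s).
  by rewrite in_itv/= => /andP[ms sm]; rewrite /A clampK// !ltW.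
have dF' s : s \in `]m - r, m + r[ ->
    is_derive s 1 F (frenet_mx (kappa s) (tau s) *m F s).
  by move=> sJ; rewrite -AE//; exact: dF.
exists r, (f 0), (f 1), (f 2%:R); split=> //.
- move=> s; rewrite in_itv/= => /andP[ms sm].
  by have [|sI _ _] := hK s; first by rewrite !ltW.
- move=> i; have -> : (fun s => f 0 s i 0) = (fun s => F s 0 i).
    by apply/funext => s; rewrite !mxE.
  exact: cF.
- by move=> s sJ; rewrite -FE -[rows3 _ _ _](congr1 (fun g => g s) FE); exact: dF'.
move=> s sJ; apply: orthonormal_det_crossv.
  rewrite -[rows3 _ _ _](congr1 (fun g => g s) FE).
  have := skew_ode_gram_constant (A := fun s => frenet_mx (kappa s) (tau s))
    (fun s _ => skew_frenet_mx _ _) dF' dF' sJ mJ.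
  by move=> ->; rewrite Fm trmx1 mul1mx.
rewrite (@frenet_ode_det_constant kappa tau _ _ _ _ _ s m _ sJ mJ).
  by rewrite -[rows3 _ _ _](congr1 (fun g => g m) FE) Fm det1.
by move=> t tJ; rewrite -FE -[rows3 _ _ _](congr1 (fun g => g t) FE); exact: dF'.
Qed.

End existence.

Theorem theorem1p1 (R : realType) (a b : R) (kappa tau : R -> R) (ltab : a < b)
  (dkappa : forall s, s \in `]a, b[ -> derivable kappa s 1)
  (kappa_gt0 : forall s, s \in `]a, b[ -> 0 < kappa s)
  (ctau : forall s, s \in `]a, b[ -> {for s, continuous tau}) :
  exists c d : R, [/\ c < d, `]c, d[ `<=` `]a, b[ &
    exists alpha : R -> 'cV[R]_3,
      has_curvature_torsion `]c, d[ kappa tau alpha /\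
      forall beta : R -> 'cV[R]_3,
        has_curvature_torsion `]c, d[ kappa tau beta ->
        exists (rho : 'M[R]_3) (v : 'cV[R]_3),
          [/\ orthogonal_mx rho, 0 < \det rho &
              forall s, s \in `]c, d[ -> beta s = rho *m alpha s + v]].
Proof.
have mI : (a + b) / 2 \in `]a, b[ by rewrite in_itv/=; apply/andP; split; lra.
have ckappa s : s \in `]a, b[ -> {for s, continuous kappa}.
  by move=> /dkappa /derivable1_diffP /differentiable_continuous.
have [r [u [v [w [r0 sub cu dF uvw]]]]] := frenet_frame_exists mI ckappa ctau.
set m := _ / 2 in mI r0 sub cu dF uvw *.
pose alpha s : 'cV[R]_3 := \col_i prim m r (fun t => u t i 0) s.
have dalpha s : s \in `]m - r, m + r[ -> is_derive s 1 alpha (u s).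
  move=> sJ; apply/is_derive_mxP => i j; rewrite (ord1 j).
  have -> : (fun t => alpha t i 0) = prim m r (fun t => u t i 0).
    by apply/funext => t; rewrite mxE.
  exact: is_derive_prim.
have k0 s : s \in `]m - r, m + r[ -> 0 < kappa s by move=> /sub /kappa_gt0.
have cd : m - r < m + r by lra.
have halpha : has_curvature_torsion `]m - r, m + r[ kappa tau alpha.
  by apply: (@has_curvature_torsion_of_frame _ _ _ _ _ _ u v w) => // s /sub /dkappa.
exists (m - r), (m + r); split=> //; exists alpha; split=> // beta hbeta.
exact: curve_rigidity cd k0 halpha hbeta.
Qed.
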